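(* Let $n$ be a positive integer, let $\mathcal{I}$ be the set of Bruhat intervals $[u,v]$ (with $u \leq v$) in the symmetric group $S_n$, and for $I \in \mathcal{I}$ let $a(I)$ and $c(I)$ denote the number of atoms and the number of coatoms of $I$, respectively. Then $$\max_{I \in \mathcal{I}} \bigl(c(I)-a(I)\bigr) = \lfloor n^2/4 \rfloor - n + 1.$$
   Context: The symmetric group $S_n$ is equipped with the (strong) Bruhat order: it is the partial order whose cover relations are $w \lessdot wt$ where $t$ is a transposition and $\ell(wt)=\ell(w)+1$, with $\ell$ the number of inversions. For $u \leq v$ in $S_n$, the Bruhat interval is $[u,v]=\{w \in S_n : u \leq w \leq v\}$. The atoms of $[u,v]$ are the elements $w$ with $u \lessdot w \leq v$, and the coatoms of $[u,v]$ are the elements $w$ with $u \leq w \lessdot v$. *)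

(* Defs.v *)
From mathcomp Require Import all_boot all_order all_algebra all_fingroup.

Set Implicit Arguments.
Unset Strict Implicit.
Unset Printing Implicit Defensive.

Section Bruhat.
Variable n : nat.
Implicit Types u v w : 'S_n.

Definition inversions w : {set 'I_n * 'I_n} :=
  [set p : 'I_n * 'I_n | (p.1 < p.2) && (w p.2 < w p.1)].

Definition perm_length w : nat := #|inversions w|.

(* [bruhat_cover w x] is w <. x.  The product of permutations satisfies
   (s * t) i = t (s i), so the function composition w o t, i.e. the element
   written wt in the usual convention, is [(t * w)%g]. *)
Definition bruhat_cover w x : bool :=
  [exists i : 'I_n, exists j : 'I_n,
     (i != j) && (x == (tperm i j * w)%g)]
  && (perm_length x == (perm_length w).+1).

Definition bruhat_le : rel 'S_n := connect bruhat_cover.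

(* An interval [u, v] with u <= v is represented by its pair of endpoints,
   which it determines (as its least and greatest elements). *)
Definition atoms u v : {set 'S_n} :=
  [set w | bruhat_cover u w && bruhat_le w v].

Definition coatoms u v : {set 'S_n} :=
  [set w | bruhat_le u w && bruhat_cover w v].

End Bruhat.

(* Main.v *)
Require Import Defs.
From mathcomp Require Import all_boot all_order all_algebra all_fingroup.
From mathcomp Require Import zify.
Import Order.TTheory GRing.Theory Num.Theory.

(* Join positions i and j when exchanging the entries of u (resp. v) in these
   positions gives an atom (resp. a coatom) of [u, v].  The coatom graph is
   triangle-free.  Moreover any labelling of the positions that is constant
   along atom edges is invariant under u^-1 v: this follows by induction along
   a chain, since two reflections t, s with u <. ut <. uts admit another atom
   ut' of [u, uts] such that s lies in the group generated by t and t'.  Hence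
   coatom edges stay inside the k components of the atom graph, of which there
   are at least n - a.  Adding k - 1 edges that join the components by a star
   keeps the coatom graph triangle-free, so c + k - 1 <= n^2/4 by Mantel.
   Equality holds for u = 1 and v the rotation by n/2: all descents of v give
   coatoms, and the atoms are among the n - 1 adjacent transpositions. *)

(** * Effect of a transposition on the length *)

Section Length.
Variable n : nat.
Implicit Types (u v w x : 'S_n) (i j k l : 'I_n).

Lemma ord_ltn_neq i j : i < j -> (i != j) * (j != i).
Proof. by move=> ij; rewrite -!val_eqE /=; split; lia. Qed.

(* Injects the inversions of w other than (i, j) into those of wt, t = (i j),
   by moving both positions unless this would reverse their order. *)
Definition push_pair i j (p : 'I_n * 'I_n) : 'I_n * 'I_n :=
  let q := (tperm i j p.1, tperm i j p.2) in
  if q.1 < q.2 then q else p.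

Lemma push_pair_inj i j :
  {in [pred p : 'I_n * 'I_n | p.1 < p.2] &, injective (push_pair i j)}.
Proof.
move=> [a b] [c d]; rewrite !inE /push_pair /= => ab cd.
case: ifP => h1; case: ifP => h2 [] e1 e2.
- by rewrite (perm_inj e1) (perm_inj e2).
- by move: h2; rewrite -e1 -e2 !tpermK ab.
- by move: h1; rewrite e1 e2 !tpermK cd.
- by rewrite e1 e2.
Qed.

(** A moved pair keeps its two values. A pair stays in place only if one position is [i] or [j] and
    the other lies strictly between; [below] handles the end [i] and [above] the end [j]. *)
Lemma push_inversion w i j :
  i < j ->
  (forall m : 'I_n, i < m < j -> w m < w i -> w m < w j) ->
  (forall m : 'I_n, i < m < j -> w j < w m -> w i < w m) ->
  {in inversions w :\ (i, j), forall p,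
    push_pair i j p \in inversions (tperm i j * w)%g :\ (i, j)}.
Proof.
move=> ij below above [a b]; rewrite !inE /push_pair /=.
move=> /andP[nab /andP[ab wab]].
case: ifP => /= h.
  rewrite !permM !tpermK h wab !andbT.
  apply/eqP => -[e1 e2].
  have ea : a = j by rewrite -(tpermK i j a) e1 tpermL.
  have eb : b = i by rewrite -(tpermK i j b) e2 tpermR.
  by move: ab; rewrite ea eb; lia.
rewrite !permM ab nab /=; move: h nab.
case: tpermP => [ea|ea|/eqP n1 /eqP n2]; case: tpermP => [eb|eb|/eqP n3 /eqP n4];
  subst; rewrite ?eqxx ?xpair_eqE -?val_eqE /= => h nab; try lia.
- by apply: below wab; rewrite ab ltn_neqAle n4 leqNgt h.
- by apply: above wab; rewrite ab andbT ltn_neqAle eq_sym n1 leqNgt h.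
Qed.

Lemma leq_card_inversions w i j :
  i < j ->
  (forall m : 'I_n, i < m < j -> w m < w i -> w m < w j) ->
  (forall m : 'I_n, i < m < j -> w j < w m -> w i < w m) ->
  #|inversions w :\ (i, j)| <= #|inversions (tperm i j * w)%g :\ (i, j)|.
Proof.
move=> ij below above.
have <- : #|push_pair i j @: (inversions w :\ (i, j))|
          = #|inversions w :\ (i, j)|.
  apply: card_in_imset => p q /setD1P[_]; rewrite inE => /andP[hp _] /setD1P[_].
  by rewrite inE => /andP[hq _]; apply: push_pair_inj.
apply: subset_leq_card; apply/subsetP => _ /imsetP[p hp ->].
exact: push_inversion hp.
Qed.

Lemma length_tperm_gt w i j :
  i < j -> w i < w j -> perm_length w < perm_length (tperm i j * w)%g.
Proof.
move=> ij wij.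
have ijNw : (i, j) \notin inversions w by rewrite inE /= ij -leqNgt ltnW.
have ijw : (i, j) \in inversions (tperm i j * w)%g.
  by rewrite inE /= !permM tpermL tpermR ij.
rewrite /perm_length (cardsD1 (i, j)) (negbTE ijNw) add0n.
rewrite [X in _ < X](cardsD1 (i, j)) ijw add1n ltnS.
by apply: leq_card_inversions => // m mij; lia.
Qed.

Lemma length_tperm_lt w i j :
  i < j -> w j < w i -> perm_length (tperm i j * w)%g < perm_length w.
Proof.
move=> ij wji; rewrite -{2}(mulKg (tperm i j) w) tpermV.
by apply: length_tperm_gt; rewrite // !permM tpermL tpermR.
Qed.

Lemma length_tperm_ltE w i j :
  i < j -> (w i < w j) = (perm_length w < perm_length (tperm i j * w)%g).
Proof.
move=> ij; case: (ltngtP (w i) (w j)) => [h|h|/val_inj/perm_inj h].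
- by rewrite length_tperm_gt.
- by apply/esym/negbTE; rewrite -leqNgt ltnW // length_tperm_lt.
- by move: ij; rewrite h ltnn.
Qed.

(** When no intermediate position carries an intermediate value, the conditions of
    [leq_card_inversions] hold for a descent too, so [(i, j)] accounts for the whole loss of
    length. *)
Lemma length_tperm_empty w i j :
  i < j -> w j < w i ->
  (forall m : 'I_n, i < m < j -> ~~ (w j < w m < w i)) ->
  perm_length w = (perm_length (tperm i j * w)%g).+1.
Proof.
move=> ij wji empty; apply/eqP; rewrite eqn_leq length_tperm_lt // andbT.
have ijw : (i, j) \in inversions w by rewrite inE /= ij.
have neq (a b : 'I_n) : a < b -> (w a != w b :> nat).
  by move=> ab; rewrite (inj_eq val_inj) (inj_eq perm_inj) -val_eqE /=; lia.
rewrite /perm_length (cardsD1 (i, j)) ijw add1n ltnS.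
apply: leq_trans (leq_card_inversions _ _ _ ij _ _) (subset_leq_card (subsetDl _ _)).
  by move=> m mij; have := empty _ mij; have := neq m j; lia.
by move=> m mij; have := empty _ mij; have := neq i m; lia.
Qed.

Lemma bruhat_cover_tperm w i j : i != j ->
  bruhat_cover w (tperm i j * w)%g
  = (perm_length (tperm i j * w)%g == (perm_length w).+1).
Proof.
move=> ij; rewrite /bruhat_cover; case: existsP => // -[]; exists i.
by apply/existsP; exists j; rewrite ij eqxx.
Qed.

Lemma bruhat_cover_ex w x : bruhat_cover w x ->
  exists i j, [/\ i < j, w i < w j & x = (tperm i j * w)%g].
Proof.
move=> /andP[/existsP[i /existsP[j /andP[neq_ij /eqP x_def]]] /eqP len_x].
have [ij|ji] : i < j \/ j < i.
    by case: (ltngtP i j) => [||/val_inj e]; [left|right|rewrite e eqxx in neq_ij].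
  by exists i, j; split; rewrite // length_tperm_ltE // -x_def len_x.
exists j, i; split; rewrite // 1?tpermC // length_tperm_ltE //.
by rewrite tpermC -x_def len_x.
Qed.

End Length.

(** * Intervals of length two *)

Section Diamond.
Variable n : nat.
Implicit Types (u v w x : 'S_n) (i j k l : 'I_n).

(** Each ascent adds at least one to the length and the total gain is two, so each adds exactly
    one. *)
Lemma bruhat_cover_two_steps u v i j k l :
  perm_length v = (perm_length u).+2 ->
  i < j -> u i < u j -> k < l ->
  (tperm i j * u)%g k < (tperm i j * u)%g l ->
  (tperm k l * (tperm i j * u))%g = v ->
  bruhat_cover u (tperm i j * u)%g /\ bruhat_cover (tperm i j * u)%g v.
Proof.
move=> len_v ij uij kl ukl def_v.
have := length_tperm_gt _ u _ _ ij uij; have := length_tperm_gt _ _ _ _ kl ukl.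
rewrite -{1}def_v !bruhat_cover_tperm ?def_v ?len_v -?val_eqE /=; lia.
Qed.

(** The clause on [f] expresses that [k] and [l] are connected by the edges [(i, j)] and [(a, b)],
    in the form needed for labellings. *)
Lemma bruhat_diamond u i j k l :
  bruhat_cover u (tperm i j * u)%g ->
  bruhat_cover (tperm i j * u)%g (tperm k l * (tperm i j * u))%g ->
  i < j -> k < l ->
  exists a b, [/\ bruhat_cover u (tperm a b * u)%g,
    bruhat_cover (tperm a b * u)%g (tperm k l * (tperm i j * u))%g &
    forall f : 'I_n -> 'I_n, f i = f j -> f a = f b -> f k = f l].
Proof.
move=> cov1 cov2 ij kl.
set v := (tperm k l * (tperm i j * u))%g in cov2 *.
have len1 : perm_length (tperm i j * u)%g = (perm_length u).+1.
  by case/andP: cov1 => _ /eqP.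
have len2 : perm_length v = (perm_length u).+2.
  by case/andP: cov2 => _ /eqP ->; rewrite len1.
have uij : u i < u j by rewrite length_tperm_ltE // len1.
have ukl : (tperm i j * u)%g k < (tperm i j * u)%g l.
  by rewrite length_tperm_ltE // -/v len1 len2.
(* The product of the reflections t = (i j) and s = (k l) can be rewritten with
   s first (A) or with the conjugate of s by t first (B). *)
have defA : (tperm (tperm k l i) (tperm k l j) * (tperm k l * u))%g = v.
  rewrite /v !mulgA; congr (_ * _)%g.
  by rewrite -tpermJ conjgE tpermV -!mulgA tperm2 mulg1.
have defB : (tperm i j * (tperm (tperm i j k) (tperm i j l) * u))%g = v.
  rewrite /v !mulgA; congr (_ * _)%g.
  by rewrite -tpermJ -conjgC.
(* [A] and [B] reduce each factorization to two ascents; [c < d] are the positions of the conjugated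
   transposition in increasing order. *)
have A (c d : 'I_n) : c < d -> tperm c d = tperm (tperm k l i) (tperm k l j) ->
   u k < u l -> (tperm k l * u)%g c < (tperm k l * u)%g d ->
  exists a b, [/\ bruhat_cover u (tperm a b * u)%g,
    bruhat_cover (tperm a b * u)%g v &
    forall f : 'I_n -> 'I_n, f i = f j -> f a = f b -> f k = f l].
  move=> cd e1 ukl' ucd; exists k, l.
  by case: (bruhat_cover_two_steps _ _ _ _ _ _ len2 kl ukl' cd ucd) => [|c1 c2]; first by rewrite e1.
have B (c d : 'I_n) : c < d -> tperm c d = tperm (tperm i j k) (tperm i j l) ->
   u c < u d -> (tperm c d * u)%g i < (tperm c d * u)%g j ->
  exists a b, [/\ bruhat_cover u (tperm a b * u)%g,
    bruhat_cover (tperm a b * u)%g v &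
    forall f : 'I_n -> 'I_n, f i = f j -> f a = f b -> f k = f l].
  move=> cd e1 ucd ucd'; exists c, d.
  case: (bruhat_cover_two_steps _ _ _ _ _ _ len2 cd ucd ij ucd') => [|c1 c2]; first by rewrite e1.
  split=> // f fij fcd.
  have inv (x y z : 'I_n) : f x = f y -> f (tperm x y z) = f z by case: tpermP => [->|->|].
  rewrite -[LHS](inv i j k fij) -[RHS](inv i j l fij).
  by rewrite -[LHS](inv c d _ fcd) e1 tpermL.
have neq (a b : 'I_n) : a != b -> (u a != u b :> nat).
  by rewrite (inj_eq val_inj) (inj_eq perm_inj).
have uD (a b c : 'I_n) : a != c -> b != c -> (tperm a b * u)%g c = u c.
  by move=> ac bc; rewrite permM tpermD.
have uL (a b : 'I_n) : (tperm a b * u)%g a = u b by rewrite permM tpermL.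
have uR (a b : 'I_n) : (tperm a b * u)%g b = u a by rewrite permM tpermR.
have sym (a b : 'I_n) : a != b -> (a != b) * (b != a).
  by move=> ab; rewrite [b == a]eq_sym ab.
have [nij nkl] := (ord_ltn_neq _ _ _ ij, ord_ltn_neq _ _ _ kl).
(* Disjoint transpositions commute, so [A] applies. If one position is shared, the choice between
   [A] and [B] depends on the two other positions: on their order if the shared one is the left end
   of both pairs or the right end of both, otherwise on the order of their values after the first
   swap. *)
case: (eqVneq k i) => [eki|nki].
  subst k; case: (eqVneq l j) => [elj|nlj].
    by subst l; move: ukl; rewrite uL uR; lia.
  have D := (nij, nkl, sym _ _ nlj).
  move: ukl; rewrite uL uD ?D // => ujl.
  case: (ltngtP j l) => [jl|lj|/val_inj e]; last by rewrite e eqxx in nlj.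
    by apply: (B j l); rewrite ?tpermL ?tpermD ?uL ?uD ?D //; lia.
  by apply: (A l j); rewrite ?tpermL ?tpermD ?uR ?uD ?D //; lia.
case: (eqVneq k j) => [ekj|nkj].
  have nli : l != i by rewrite -val_eqE /=; move: kl; rewrite ekj; lia.
  subst k; have D := (nij, nkl, sym _ _ nli).
  move: ukl; rewrite uR uD ?D // => uil.
  case: (ltngtP (u l) (u j)) => [ulj|ujl|e]; last by have := neq l j; rewrite D; lia.
    apply: (B i l); rewrite ?tpermR ?tpermD ?uL ?uD ?D //; lia.
  apply: (A i l); rewrite ?tpermL ?tpermD ?uR ?uL ?uD ?D //; lia.
case: (eqVneq l i) => [eli|nli].
  subst l; have D := (nij, nkl, sym _ _ nkj).
  move: ukl; rewrite uL uD ?D // => ukj.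
  case: (ltngtP (u k) (u i)) => [uki|uik|e]; last by have := neq k i; rewrite D; lia.
    apply: (A k j); rewrite ?tpermR ?tpermD ?uL ?uR ?uD ?D //; lia.
  apply: (B k j); rewrite ?tpermL ?tpermD ?uR ?uL ?uD ?D //; lia.
case: (eqVneq l j) => [elj|nlj].
  subst l; have D := (nij, nkl, sym _ _ nki).
  move: ukl; rewrite uR uD ?D // => uki.
  case: (ltngtP k i) => [ki|ik|/val_inj e]; last by rewrite e eqxx in nki.
    apply: (B k i); rewrite ?tpermR ?tpermD ?uL ?uR ?uD ?D //; lia.
  apply: (A i k); rewrite ?tpermR ?tpermL ?tpermD ?uR ?uL ?uD ?D //; lia.
have D := (nij, nkl, (sym _ _ nki, sym _ _ nkj), (sym _ _ nli, sym _ _ nlj)).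
move: ukl; rewrite !uD ?D // => ukl.
by apply: (A i j); rewrite ?tpermD ?uD ?D.
Qed.
End Diamond.

(** * Labellings constant along atom edges, and the edges of coatoms *)

Section Labels.
Variable n : nat.
Implicit Types (u v w x : 'S_n) (i j k l : 'I_n).

Definition atom_invariant u v (f : 'I_n -> 'I_n) :=
  forall i j, (tperm i j * u)%g \in atoms u v -> f i = f j.

Lemma comp_tperm_id (f : 'I_n -> 'I_n) i j k :
  f i = f j -> f (tperm i j k) = f k.
Proof. by case: tpermP => [->|->|]. Qed.

Lemma atom_invariant_perm u v f :
  bruhat_le u v -> atom_invariant u v f ->
  forall z, f ((u^-1)%g (v z)) = f z.
Proof.
case/connectP=> p; elim: p u => [|u' p IHp] u /=.
  by move=> _ -> _ z; rewrite permK.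
case/andP=> cov path_p def_v inv z.
have le_u'v : bruhat_le u' v by apply/connectP; exists p.
have [i [j [ij _ def_u']]] := bruhat_cover_ex _ _ _ cov.
subst u'.
have fij : f i = f j by apply: inv; rewrite inE cov.
(* The hypothesis passes to the upper interval: the diamond turns an atom of [[u', v]] into a second
   atom of [[u, v]], and the two atom edges force the label equality. *)
have inv' : atom_invariant (tperm i j * u)%g v f.
  move=> k' l'; rewrite inE => /andP[cov'].
  have [k [l [kl _ e]]] := bruhat_cover_ex _ _ _ cov'.
  have /mulIg tE := e; rewrite e => le_v.
  rewrite e in cov'.
  have [a [b [cov_a cov_b fkl]]] := bruhat_diamond _ _ _ _ _ _ cov cov' ij kl.
  have fab : f a = f b.
    by apply: inv; rewrite inE cov_a; apply: connect_trans (connect1 cov_b) le_v.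
  by rewrite -(comp_tperm_id f k l k' (fkl f fij fab)) -tE tpermL.
rewrite -(IHp _ path_p def_v inv' z) invMg tpermV permM.
by rewrite comp_tperm_id.
Qed.

(** Atoms of [[u, vt]] are atoms of [[u, v]], so [f] is invariant under both [u^-1 v] and [u^-1 vt].
    The first sends [i] where the second sends [j]. *)
Lemma atom_invariant_coatom u v f i j :
  atom_invariant u v f -> (tperm i j * v)%g \in coatoms u v -> f i = f j.
Proof.
move=> inv; rewrite inE => /andP[le_u cov].
have le_uv : bruhat_le u v by apply: connect_trans le_u (connect1 cov).
have inv' : atom_invariant u (tperm i j * v)%g f.
  move=> a b; rewrite inE => /andP[cov_a le_a]; apply: inv.
  by rewrite inE cov_a; apply: connect_trans le_a (connect1 cov).
rewrite -(atom_invariant_perm _ _ _ le_uv inv i).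
by rewrite -(atom_invariant_perm _ _ _ le_u inv' j) permM tpermR.
Qed.

Lemma tperm_lt_inj i j k l :
  i < j -> k < l -> tperm i j = tperm k l -> (i, j) = (k, l).
Proof.
move=> ij kl e; have := tpermL i j; rewrite e.
case: tpermP => [-> <- // | il jk | _ _ ji].
  by move: ij kl; rewrite il -jk; lia.
by move: ij; rewrite ji ltnn.
Qed.

(** The edges of the atom or coatom graph, each listed once, from its smaller position to its larger
    one. *)
Definition swaps_into w (S : {set 'S_n}) : {set 'I_n * 'I_n} :=
  [set p : 'I_n * 'I_n | (p.1 < p.2) && ((tperm p.1 p.2 * w)%g \in S)].

Lemma card_swaps_into w (S : {set 'S_n}) :
  {in S, forall x, exists i j, i < j /\ x = (tperm i j * w)%g} ->
  #|swaps_into w S| = #|S|.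
Proof.
move=> hS; rewrite -(card_in_imset (f := fun p => (tperm p.1 p.2 * w)%g)).
  apply: eq_card => x; apply/imsetP/idP => [[p]|hx].
    by rewrite inE => /andP[_ hp] ->.
  have [i [j [ij def_x]]] := hS x hx.
  by exists (i, j); rewrite // inE /= ij -def_x.
move=> [i j] [k l]; rewrite !inE /= => /andP[ij _] /andP[kl _] /mulIg.
exact: tperm_lt_inj.
Qed.

Lemma card_swaps_atoms u v : #|swaps_into u (atoms u v)| = #|atoms u v|.
Proof.
apply: card_swaps_into => x; rewrite inE => /andP[/bruhat_cover_ex].
by case=> i [j [ij _ ->]] _; exists i, j.
Qed.

Lemma card_swaps_coatoms u v : #|swaps_into v (coatoms u v)| = #|coatoms u v|.
Proof.
apply: card_swaps_into => x; rewrite inE => /andP[_ /bruhat_cover_ex].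
by case=> i [j [ij _ ->]]; exists i, j; rewrite mulgA tperm2 mul1g.
Qed.

(** Here [v k < v j < v i], and (i k) = (i j)(j k)(i j) is reached from [v] by three successive
    descents. The length thus drops by at least three, whereas a coatom drops it by one. *)
Lemma coatoms_triangle_free u v i j k : i < j -> j < k ->
  (tperm i j * v)%g \in coatoms u v -> (tperm j k * v)%g \in coatoms u v ->
  (tperm i k * v)%g \notin coatoms u v.
Proof.
have desc (a b : 'I_n) : a < b -> (tperm a b * v)%g \in coatoms u v ->
    v b < v a /\ perm_length v = (perm_length (tperm a b * v)%g).+1.
  move=> ab; rewrite inE => /andP[_ /andP[_ /eqP len_v]]; split=> //.
  have: (tperm a b * v)%g a < (tperm a b * v)%g b.
    by rewrite length_tperm_ltE // mulgA tperm2 mul1g len_v.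
  by rewrite !permM tpermL tpermR.
move=> ij jk cij cjk; apply/negP => cik.
have [vji _] := desc _ _ ij cij; have [vkj _] := desc _ _ jk cjk.
have ik := ltn_trans ij jk; have [_ len_v] := desc _ _ ik cik.
have D := (ord_ltn_neq _ _ _ ij, ord_ltn_neq _ _ _ jk, ord_ltn_neq _ _ _ ik).
have l1 := length_tperm_lt _ v _ _ ij vji.
have l2 : perm_length (tperm j k * (tperm i j * v))%g < perm_length (tperm i j * v)%g.
  by apply: length_tperm_lt; rewrite // !permM tpermR tpermD ?D //; lia.
have l3 : perm_length (tperm i j * (tperm j k * (tperm i j * v)))%g
          < perm_length (tperm j k * (tperm i j * v))%g.
  by apply: length_tperm_lt; rewrite // !permM tpermL (@tpermD _ i j k) ?(@tpermD _ j k i) ?D ?tpermL.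
have e : (tperm i j * (tperm j k * (tperm i j * v)) = tperm i k * v)%g.
  rewrite !mulgA; congr (_ * _)%g.
  have <- : (tperm j k ^ tperm i j = tperm i k)%g by rewrite tpermJ tpermR tpermD ?D.
  by rewrite conjgE tpermV mulgA.
by move: l3; rewrite e; lia.
Qed.
End Labels.

(** * Triangle-free graphs and labels *)

Section Graphs.
Variable T : finType.

(* If A is a maximum independent set, every degree is at most #|A|
   (neighbourhoods are independent) and every edge has an end outside A, so
   there are at most #|A| * (#|T| - #|A|) edges.  Each edge is counted twice. *)
Lemma mantel (e : rel T) :
  symmetric e -> (forall x y z, e x y -> e y z -> e x z -> False) ->
  #|[set p : T * T | e p.1 p.2]| <= (#|T| ^ 2 %/ 4).*2.
Proof.
move=> sym_e tri_e.
pose indep (A : {set T}) := [forall x in A, forall y in A, ~~ e x y].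
have indep0 : indep set0 by apply/forall_inP => x; rewrite inE.
case: (@arg_maxnP _ set0 indep (fun A => #|A|) indep0) => A indepA maxA.
have degA x : #|[set y | e x y]| <= #|A|.
  apply: maxA; apply/forall_inP => y; rewrite inE => exy.
  apply/forall_inP => z; rewrite inE => exz; apply/negP => eyz.
  exact: tri_e exy eyz exz.
pose out := [set p : T * T | (p.1 \notin A) && e p.1 p.2].
have card_out : #|out| <= #|~: A| * #|A|.
  rewrite -sum1_card (eq_bigl (fun p => (p.1 \in ~: A) && e p.1 p.2)); last first.
    by move=> p; rewrite !inE.
  rewrite -(pair_big_dep (fun x => x \in ~: A) e (fun _ _ => 1)) /=.
  rewrite -sum_nat_const; apply: leq_sum => x _; rewrite sum1_card.
  by apply: leq_trans (degA x); rewrite cardsE.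
pose swap (p : T * T) := (p.2, p.1).
have sub : [set p : T * T | e p.1 p.2] \subset out :|: swap @^-1: out.
  apply/subsetP => -[x y]; rewrite !inE /= [e y x]sym_e => exy.
  rewrite exy !andbT -negb_and; apply/negP => /andP[xA yA].
  by move/forall_inP/(_ x xA)/forall_inP/(_ y yA): indepA; rewrite exy.
have swapK : involutive swap by case.
apply: leq_trans (subset_leq_card sub) _.
apply: leq_trans (leq_card_setU _ _) _.
rewrite (@card_preimset _ swap out (inv_inj swapK)) addnn leq_double.
apply: leq_trans card_out _; rewrite leq_divRL // -(cardsC A).
by rewrite [X in X <= _]mulnC [X in 4 * X]mulnC; apply: nat_AGM2.
Qed.

(** An idempotent map encodes a partition by representatives. Adding a pair [(a, b)] merges the
    class of [b] into that of [a], which loses at most the fixed point [f b]. *)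
Lemma exists_labels (s : seq (T * T)) :
  exists f : T -> T,
    [/\ forall x, f (f x) = f x, {in s, forall p, f p.1 = f p.2}
      & #|T| <= #|[set x | f x == x]| + size s].
Proof.
elim: s => [|[a b] s [f [ff fs le_s]]].
  exists id; split=> //; rewrite addn0 -cardsT subset_leq_card //.
  by apply/subsetP => x; rewrite !inE eqxx.
pose g x := if f x == f b then f a else f x.
exists g; split.
- move=> x; rewrite /g; case: (eqVneq (f x) (f b)) => [|neq].
    by rewrite !ff => _; case: eqP.
  by rewrite !ff (negbTE neq).
- move=> p; rewrite inE => /predU1P[->|/fs e]; last by rewrite /g e.
  by rewrite /g /= eqxx; case: eqP.
apply: leq_trans le_s _; rewrite addnS -addSn leq_add2r.
apply: leq_trans (_ : #|f b |: [set x | g x == x]| <= _); last first.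
  by rewrite cardsU1; case: (_ \notin _).
apply: subset_leq_card; apply/subsetP => x; rewrite !inE /g => /eqP fx.
by rewrite fx; case: eqP => //= _; rewrite eqxx.
Qed.

(* Joining the fixed points of f, one per label, by a star creates no triangle. *)
Lemma mantel_labels (E : {set T * T}) (f : T -> T) (x0 : T) :
  let e x y := ((x, y) \in E) || ((y, x) \in E) in
  (forall x y, (x, y) \in E -> (y, x) \notin E) ->
  (forall x y z, e x y -> e y z -> e x z -> False) ->
  (forall x, f (f x) = f x) -> {in E, forall p, f p.1 = f p.2} ->
  #|E| + #|[set x | f x == x]| <= (#|T| ^ 2 %/ 4).+1.
Proof.
move=> e anti tri ff fE; pose r := f x0; have fr : f r = r by apply: ff.
pose star := [set (r, y) | y in [set y | f y == y] :\ r].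
have starP x y : (x, y) \in star -> [/\ x = r, f y = y & x <> y].
  by case/imsetP=> z; rewrite !inE => /andP[/eqP zr /eqP fz] [-> ->]; split=> // /esym.
have card_star : #|[set x | f x == x]| = #|star|.+1.
  rewrite card_imset; last by move=> y z [].
  by rewrite (cardsD1 r) inE ff eqxx.
pose F := E :|: star.
have card_F : #|F| = #|E| + #|star|.
  apply/eqP; rewrite (leq_card_setU E star).2 -setI_eq0; apply/eqP/setP => -[x y].
  rewrite !inE; apply/negP => /andP[/fE /= fxy /starP[xr fy xy]].
  by apply: xy; rewrite -fy -fxy xr fr.
pose h x y := ((x, y) \in F) || ((y, x) \in F).
have hP x y : h x y -> e x y \/ [/\ f x = x, f y = y, x <> y & x = r \/ y = r].
  rewrite /h /e !inE => /orP[]/orP[->|/starP[h1 h2 h3]]; rewrite ?orbT; auto; right;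
    by split; auto; rewrite h1.
have eP x y : e x y -> f x = f y by case/orP => /fE.
have exx x : e x x -> False by move=> exx; apply: (tri x x x).
have sym_h : symmetric h by move=> x y; rewrite /h orbC.
have tri_h x y z : h x y -> h y z -> h x z -> False.
  have one_e a b : e a b -> f a = a -> f b = b -> False.
    by move=> eab fa fb; apply: (exx a); rewrite -{2}fa (eP _ _ eab) fb.
  (* Two sides in [E] give the ends of a star edge the same label; one side in [E] would join two
     distinct fixed points; three star edges would make two distinct vertices equal to [r]. *)
  move=> /hP[exy|[x1 y1 xy1 r1]] /hP[eyz|[y2 z2 yz2 r2]] /hP[exz|[x3 z3 xz3 r3]].
  - exact: tri exy eyz exz.
  - by have := eP _ _ exy; have := eP _ _ eyz; congruence.
  - by have := eP _ _ exy; have := eP _ _ exz; congruence.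
  - exact: one_e exy x3 y2.
  - by have := eP _ _ eyz; have := eP _ _ exz; congruence.
  - exact: one_e eyz y1 z3.
  - exact: one_e exz x1 z2.
  - by case: r1 r2 r3 => [xr|yr] [yr'|zr] [xr'|zr']; congruence.
pose swap (p : T * T) := (p.2, p.1).
have swapK : involutive swap by case.
(* [mantel] counts ordered pairs, so [F] and its reversal must be disjoint for each edge to
   contribute two. *)
have disj : [disjoint F & swap @^-1: F].
  rewrite -setI_eq0; apply/eqP/setP => -[x y]; rewrite !inE /swap /=.
  apply/negP => /andP[/orP[Exy|/starP[xr fy xy]] /orP[Eyx|/starP[yr fx yx]]].
  - by move: Eyx; apply/negP/anti.
  - by apply: yx; rewrite -fx (fE _ Exy) /= yr fr.
  - by apply: xy; rewrite -fy (fE _ Eyx) /= xr fr.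
  - by congruence.
have sub : F :|: swap @^-1: F \subset [set p : T * T | h p.1 p.2].
  by apply/subsetP => -[x y]; rewrite !(inE, in_setU) /h /swap /= !inE.
have := leq_trans (subset_leq_card sub) (mantel h sym_h tri_h).
move: disj; rewrite -(leq_card_setU F (swap @^-1: F)).2 => /eqP ->.
by rewrite (@card_preimset _ swap F (inv_inj swapK)) card_F card_star; lia.
Qed.
End Graphs.

(** * The upper bound and the extremal interval *)

Section Bounds.
Variable n : nat.
Implicit Types (u v w x : 'S_n) (i j k l : 'I_n).

Lemma coatoms_le_atoms u v : 0 < n ->
  #|coatoms u v| + n <= #|atoms u v| + (n ^ 2 %/ 4).+1.
Proof.
move=> n_gt0.
have [f [ff f_atoms le_n]] := exists_labels _ (enum (swaps_into _ u (atoms u v))).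
have inv : atom_invariant _ u v f.
  move=> i j ij_atom; case: (ltngtP i j) => [ij|ji|/val_inj -> //].
    by apply: (f_atoms (i, j)); rewrite mem_enum inE ij.
  by apply/esym/(f_atoms (j, i)); rewrite mem_enum inE ji /= tpermC.
pose E := swaps_into _ v (coatoms u v).
have EP i j : (i, j) \in E -> i < j /\ (tperm i j * v)%g \in coatoms u v.
  by rewrite inE => /andP.
have anti i j : (i, j) \in E -> (j, i) \notin E.
  by move/EP => [ij _]; rewrite inE /= ltnNge ltnW.
have tri i j k : i < j -> j < k -> (i, j) \in E -> (j, k) \in E -> (i, k) \in E -> False.
  move=> ij jk /EP[_ cij] /EP[_ cjk] /EP[_ cik].
  by have := coatoms_triangle_free _ _ _ _ _ _ ij jk cij cjk; rewrite cik.
have := mantel_labels _ E f (Ordinal n_gt0) anti _ ff.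
rewrite card_ord /E card_swaps_coatoms => main.
move: le_n; rewrite card_ord -cardE card_swaps_atoms => le_n.
suff: #|coatoms u v| + #|[set x | f x == x]| <= (n ^ 2 %/ 4).+1 by lia.
apply: main => [i j k|[i j] /EP[_ cij]]; last exact: atom_invariant_coatom cij.
(* Of the eight orientations of a triangle, the two cyclic ones contradict the order of positions;
   the other six are sorted into [tri]. *)
move=> /orP[]e1 /orP[]e2 /orP[]e3;
  have [h1 _] := EP _ _ e1; have [h2 _] := EP _ _ e2; have [h3 _] := EP _ _ e3.
- exact: tri h1 h2 e1 e2 e3.
- lia.
- exact: tri h3 h2 e3 e2 e1.
- exact: tri h3 h1 e3 e1 e2.
- exact: tri h1 h3 e1 e3 e2.
- exact: tri h2 h3 e2 e3 e1.
- lia.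
- exact: tri h2 h1 e2 e1 e3.
Qed.

Lemma card_ord_ltn m : m <= n -> #|[set i : 'I_n | i < m]| = m.
Proof.
move=> mn; rewrite -sum1dep_card -(big_ord_widen n (fun _ => 1) mn).
by rewrite sum_nat_const card_ord muln1.
Qed.

Lemma perm_length0 w : perm_length w = 0 -> w = 1%g.
Proof.
move/eqP; rewrite cards_eq0 => /eqP inv0.
have mono i j : i < j -> w i < w j.
  move=> ij; rewrite ltnNge leq_eqVlt; apply/norP; split.
    by rewrite (inj_eq val_inj) (inj_eq perm_inj) (ord_ltn_neq _ _ _ ij).
  by have /setP/(_ (i, j)) := inv0; rewrite !inE /= ij => /negbT.
apply/permP => i; rewrite perm1; apply: val_inj => /=.
(* By monotonicity, [i] and [w i] both count the positions before [i]. *)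
rewrite -(card_ord_ltn i) 1?ltnW // -(card_ord_ltn (w i)) 1?ltnW //.
rewrite -(@card_preimset _ w _ perm_inj); apply: eq_card => j; rewrite !inE.
case: (ltngtP j i) => [ji|ij|/val_inj ->]; last by rewrite ltnn.
  exact: mono.
by rewrite ltnNge ltnW // mono.
Qed.

(** Undoing an inversion of minimal width is a cover, since an intermediate value in between would
    give a narrower inversion; induction on the length concludes. *)
Lemma bruhat_le1 w : bruhat_le 1%g w.
Proof.
move: {2}(perm_length w) (leqnn (perm_length w)) => m.
elim: m w => [|m IHm] w le_m.
  by have -> : w = 1%g; [apply: perm_length0; lia | apply: connect0].
have [|/set0Pn[p0 p0_inv]] := boolP (inversions w == set0).
  rewrite -cards_eq0 => /eqP len0; rewrite (perm_length0 w len0); exact: connect0.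
case: (@arg_minnP _ p0 (mem (inversions w)) (fun p => p.2 - p.1) p0_inv) => -[i j] /=.
rewrite inE /= => /andP[ij wji] min_ij.
have empty (m' : 'I_n) : i < m' < j -> ~~ (w j < w m' < w i).
  move=> mij; apply/negP => /andP[h1 h2].
  have := min_ij (i, m'); rewrite inE /= h2 andbT => /(_ _); lia.
have len_w := length_tperm_empty _ _ _ _ ij wji empty.
apply: connect_trans (IHm (tperm i j * w)%g _) _; first by lia.
apply: connect1; rewrite -{2}(mulKg (tperm i j) w) tpermV bruhat_cover_tperm.
  by rewrite mulgA tperm2 mul1g len_w.
by rewrite (ord_ltn_neq _ _ _ ij).
Qed.

(** Otherwise [(i, i+1)] and [(i, j)] are two inversions of a permutation of length one. *)
Lemma atoms1_adjacent v i j :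
  i < j -> (tperm i j * 1)%g \in atoms 1%g v -> j = i.+1 :> nat.
Proof.
rewrite mulg1 => ij; rewrite inE => /andP[/andP[_ /eqP len1] _].
have len0 : perm_length (1%g : 'S_n) = 0.
  by apply/eqP; rewrite cards_eq0; apply/eqP/setP => p; rewrite !inE !perm1; lia.
apply/eqP; rewrite eqn_leq ij andbT leqNgt; apply/negP => ij1.
have i1n : i.+1 < n by apply: ltn_trans ij1 (ltn_ord j).
pose k := Ordinal i1n.
have ik : i < k by [].
have D := (ord_ltn_neq _ _ _ ij, ord_ltn_neq _ _ _ ik, ord_ltn_neq _ k j ij1).
have : (i, j) \in inversions (tperm i j) by rewrite inE /= tpermL tpermR ij.
have : (i, k) \in inversions (tperm i j) by rewrite inE /= tpermL tpermD ?D ?ltnS ?leqnn ?ij1.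
move=> ik_inv ij_inv.
have : [set (i, j); (i, k)] \subset inversions (tperm i j).
  by apply/subsetP => p; rewrite in_set2 => /orP[]/eqP->.
move/subset_leq_card; rewrite cards2 -/(perm_length _) len1 len0.
by rewrite xpair_eqE eqxx D.
Qed.

Lemma card_atoms1 v : #|atoms 1%g v| <= n.-1.
Proof.
rewrite -card_swaps_atoms.
have adj i j : (i, j) \in swaps_into _ 1%g (atoms 1%g v) -> j = i.+1 :> nat.
  by rewrite in_set => /andP[ij]; apply: atoms1_adjacent.
have fst_inj : {in swaps_into _ 1%g (atoms 1%g v) &, injective (fun p => p.1)}.
  move=> [i j] [k l] /adj ij /adj kl /= eik.
  by subst k; congr (_, _); apply: val_inj; rewrite /= ij.
rewrite -(card_in_imset fst_inj) -(card_ord_ltn _ (leq_pred n)).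
apply: subset_leq_card; apply/subsetP => _ /imsetP[[i j] /adj ij ->].
rewrite inE /=; have := ltn_ord j; lia.
Qed.

(** For [m <= n] both branches stay below [n], so the default [i] of [insubd] is never returned. *)
Definition rot_ord (m : nat) (i : 'I_n) : 'I_n :=
  insubd i (if i < m then i + (n - m) else i - m).

Lemma val_rot_ord m i : m <= n ->
  rot_ord m i = (if i < m then i + (n - m) else i - m) :> nat.
Proof.
by move=> mn; rewrite val_insubd ifT //; have := ltn_ord i; case: (ltnP i m) => im; lia.
Qed.

Lemma rot_ord_inj m : m <= n -> injective (rot_ord m).
Proof.
move=> mn i j /(congr1 val); rewrite /= !val_rot_ord // => e; apply: val_inj => /=.
by have := ltn_ord i; have := ltn_ord j; move: e; case: (ltnP i m); case: (ltnP j m); lia.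
Qed.

(** The rotation increases on the positions before [m] and on those from [m] on, so every pair
    [i < m <= j] is an inversion with no intermediate value in between, hence a coatom. *)
Lemma coatoms_rot m (mn : m <= n) :
  m * (n - m) <= #|coatoms 1%g (perm (rot_ord_inj m mn))|.
Proof.
set v := perm _.
have vE i : v i = (if i < m then i + (n - m) else i - m) :> nat.
  by rewrite permE val_rot_ord.
rewrite -card_swaps_coatoms.
have cov i j : i < m -> m <= j -> (tperm i j * v)%g \in coatoms 1%g v.
  move=> im mj; have ij : i < j by exact: leq_trans im mj.
  rewrite inE bruhat_le1 -{2}(mulKg (tperm i j) v) tpermV bruhat_cover_tperm.
    rewrite mulgA tperm2 mul1g; apply/eqP/length_tperm_empty => //.
      by rewrite !vE im [j < m]ltnNge mj /=; have := ltn_ord j; lia.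
    by move=> k; rewrite !vE im [j < m]ltnNge mj /=; case: (ltnP k m); lia.
  by rewrite (ord_ltn_neq _ _ _ ij).
pose A := [set i : 'I_n | i < m].
have cardA : #|A| = m by apply: card_ord_ltn.
have cardCA : #|~: A| = n - m by have := cardsC A; rewrite cardA card_ord; lia.
rewrite -cardCA -{1}cardA -cardsX; apply: subset_leq_card.
apply/subsetP => -[i j] ij_AC; have /andP[im mj] : (i < m) && (m <= j).
  by move: ij_AC; rewrite !inE -leqNgt.
by rewrite in_set /= (leq_trans im mj) cov.
Qed.
End Bounds.

Theorem theoremA (n : nat) (hn : (0 < n)%N) :
  let M : int := ((n ^ 2 %/ 4)%N%:Z - n%:Z + 1)%R in
  (exists u v : 'S_n,
     bruhat_le u v /\ (#|coatoms u v|%:Z - #|atoms u v|%:Z)%R = M) /\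
  (forall u v : 'S_n,
     bruhat_le u v -> (#|coatoms u v|%:Z - #|atoms u v|%:Z <= M)%R).
Proof.
move=> M; split; last by move=> u v _; have := coatoms_le_atoms n u v hn; rewrite /M; lia.
have mn : n./2 <= n by lia.
exists 1%g, (perm (rot_ord_inj n n./2 mn)); split; first exact: bruhat_le1.
set v := perm _.
(* At most n - 1 atoms and at least n^2/4 coatoms make the general bound [h1] an equality. *)
have h1 := coatoms_le_atoms n 1%g v hn.
have h2 := card_atoms1 n v.
have h3 : n./2 * (n - n./2) <= #|coatoms 1%g v| := coatoms_rot _ _ mn.
have h4 : n./2 * (n - n./2) = n ^ 2 %/ 4.
  (* The remainder of [n ^ 2] modulo 4 is the parity of [n]. *)
  have -> : n ^ 2 = n./2 * (n - n./2) * 4 + odd n.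
    by have := odd_double_half n; rewrite -addnn; case: (odd n) => /=; nia.
  by rewrite divnMDl // divn_small ?addn0 //; case: (odd n).
by rewrite /M; lia.
Qed.
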